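(* Let $v\ge 3$ be an integer. There exist a perfect matching $I$ of the complete graph $K_v$ and a decomposition of the edge set of $K_v-I$ into $5$-star factors if and only if $v\equiv 12 \pmod{30}$. (Equivalently, for even $v\ge 4$ and any perfect matching $I$ of $K_v$, $K_v-I$ decomposes into $5$-star factors if and only if $v\equiv 12\pmod{30}$.)
   Context: A $5$-star is a copy of $K_{1,5}$. A $5$-star factor of a graph $H$ is a spanning subgraph of $H$ each of whose connected components is a $5$-star. A decomposition of $K_v-I$ into $5$-star factors is a collection of $5$-star factors of $K_v-I$ whose edge sets partition the edge set of $K_v-I$. *)

(* Defs.v *)
From mathcomp Require Import all_boot.

Set Implicit Arguments.
Unset Strict Implicit.
Unset Printing Implicit Defensive.

(* A simple graph with vertex set the whole finite type T is represented by
   its edge set, a set of two-element subsets of T.  Subgraphs given in this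
   way are therefore always spanning. *)

Definition complete_graph (T : finType) : {set {set T}} :=
  [set e : {set T} | #|e| == 2].

Definition perfect_matching (T : finType) (I : {set {set T}}) : Prop :=
  I \subset complete_graph T /\
  forall x : T, #|[set e in I | x \in e]| = 1.

Definition adj (T : finType) (F : {set {set T}}) : rel T :=
  [rel x y | [set x; y] \in F].

(* Vertex sets of the connected components; isolated vertices form singleton
   components. *)
Definition components (T : finType) (F : {set {set T}}) : {set {set T}} :=
  [set [set y | connect (adj F) x y] | x : T].

(* The graph with vertex set V and edge set F is a copy of K_{1,k}. *)
Definition is_star (T : finType) (k : nat) (V : {set T}) (F : {set {set T}}) :
    Prop :=
  exists (c : T) (L : {set T}),
    [/\ c \notin L, #|L| = k, V = c |: L & F = [set [set c; x] | x in L]].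

Definition star_factor (T : finType) (k : nat) (H F : {set {set T}}) : Prop :=
  F \subset H /\
  forall C : {set T}, C \in components F -> is_star k C (F ::&: C).

(* [partition] also asks the factors to be nonempty, which holds for every star
   factor with k > 0 as soon as T is nonempty. *)
Definition star_factor_decomposition (T : finType) (k : nat)
    (H : {set {set T}}) (D : {set {set {set T}}}) : Prop :=
  (forall F, F \in D -> star_factor k H F) /\ partition D H.

(* Main.v *)
Require Import Defs.
From mathcomp Require Import all_boot all_algebra.
From mathcomp Require Import zify.

Set Implicit Arguments.
Unset Strict Implicit.
Unset Printing Implicit Defensive.

(* Necessity is a count: a factor has v/6 components, hence 5v/6 of the
   v(v-2)/2 edges, so 6 divides v and 5 divides v-2.

   For sufficiency, a factor is encoded by the map sending each vertex to the
   centre of its star.  Let v = 30t + 12 with t <> 2, and take t cells of 30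
   points together with 12 further points.  The graph on a cell and the 12
   points, K_42 minus a matching, splits into 18 factors without an edge among
   the 12 points and 6 factors which separate the cell from the 12 points.  The
   latter are put side by side over all cells; the former, for the cell x, are
   completed by 18 partial factors covering the other cells, taken from a frame
   which decomposes the complete multipartite graph on the cells.

   If t is odd the cells are indexed by Z_t and, for the hole x, the cells y and
   2x - y are joined by a decomposition of K_{30,30} into 18 factors.  If t is
   even the cells are indexed by Z_(t-1) and a point oo; for the hole x the three
   cells oo, x + g, x - g form a triangle, on which only half of the edges of each
   bipartite graph is used.  The halves left over between x + g and x - g form
   cycles of cells, which give the factors for the hole oo.

   The finitely many small designs, and the case v = 72, are cyclic and were
   found by a computer search. *)

(** * Counting *)

Lemma adj_sym (T : finType) (F : {set {set T}}) : symmetric (adj F).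
Proof. by move=> x y; rewrite /adj /= setUC. Qed.

Lemma connect_adj_sym (T : finType) (F : {set {set T}}) :
  connect_sym (adj F).
Proof. exact/sym_connect_sym/adj_sym. Qed.

Lemma card_complete_graph (T : finType) :
  2 * #|complete_graph T| = #|T| * #|T|.-1.
Proof.
rewrite card_draws bin2 mul2n -[RHS]odd_double_half.
rewrite oddM; case: #|T| => //= n.
by case: (odd n).
Qed.

Lemma card_perfect_matching (T : finType) (I : {set {set T}}) :
  perfect_matching I -> 2 * #|I| = #|T|.
Proof.
case=> sIK Ix; rewrite mulnC -sum_nat_const.
have -> : \sum_(e in I) 2 = \sum_(e in I) \sum_(x in e) 1.
  apply: eq_bigr => e /(subsetP sIK).
  by rewrite inE sum1_card => /eqP.
rewrite (exchange_big_dep xpredT) //= -sum1_card.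
by apply: eq_bigr => x _; rewrite sum1dep_card Ix.
Qed.

Lemma card_complete_minus_matching (T : finType) (I : {set {set T}}) :
  perfect_matching I -> 2 * #|complete_graph T :\: I| = #|T| * (#|T| - 2).
Proof.
move=> pI; have := card_perfect_matching pI; have := card_complete_graph T.
case: pI => /setIidPr sI _; rewrite cardsD sI.
case: #|T| => [|[|n]] /=; nia.
Qed.

Section StarFactorCount.

Variables (T : finType) (k : nat) (H F : {set {set T}}).
Hypotheses (sHK : H \subset complete_graph T) (FH : star_factor k H F).

Let comp (x : T) := [set y | connect (adj F) x y].

Let comp_eq x y : connect (adj F) x y -> comp x = comp y.
Proof.
move=> xy; apply/setP => z; rewrite !inE.
exact: (same_connect (@connect_adj_sym _ F) xy).
Qed.

Let memcomp x : x \in comp x. Proof. by rewrite inE connect0. Qed.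

Let compP C x : C \in components F -> x \in C -> C = comp x.
Proof. by case/imsetP=> y _ ->; rewrite inE => /comp_eq. Qed.

(** Double counting of the incidences between vertices and components: [comp x] is the only
    component that contains [x]. *)
Lemma card_star_factor_vertices : #|T| = k.+1 * #|components F|.
Proof.
have -> : #|T| = \sum_(C in components F) \sum_(x in C) 1.
  rewrite (exchange_big_dep xpredT) //= -sum1_card.
  apply: eq_bigr => x _; rewrite sum1dep_card.
  rewrite (_ : [set C | _] = [set comp x]) ?cards1 //.
  apply/setP => C; rewrite !inE; apply/andP/eqP => [[]|->].
    exact: compP.
  by split; [apply: imset_f | apply: memcomp].
rewrite mulnC -sum_nat_const; apply: eq_bigr => C /FH.2 [c [L [cL <- -> _]]].
by rewrite sum1_card cardsU1 cL.
Qed.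

(** An edge lies inside exactly one component, that of its first end, so the edges can be counted
    star by star. *)
Lemma card_star_factor_edges : #|F| = k * #|components F|.
Proof.
have -> : #|F| = \sum_(C in components F) #|F ::&: C|.
  under eq_bigr => C _ do rewrite -sum1dep_card.
  rewrite (exchange_big_dep (fun e => e \in F)) /=; last first.
    by move=> C e _ /andP[].
  rewrite -sum1_card; apply: eq_bigr => e eF; rewrite sum1dep_card.
  have : e \in complete_graph T by apply: (subsetP sHK); apply: (subsetP FH.1).
  rewrite inE => /cards2P[a [b [ab def_e]]]; move: eF; rewrite {}def_e => eF.
  rewrite (_ : [set C | _] = [set comp a]) ?cards1 //.
  apply/setP => C; rewrite !inE eF /= subUset !sub1set.
  apply/andP/eqP => [[CF /andP[aC _]]|->]; first exact: compP.
  by rewrite imset_f // memcomp !inE connect1.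
rewrite mulnC -sum_nat_const; apply: eq_bigr => C /FH.2 [c [L [cL Lk _ ->]]].
rewrite card_in_imset // => x y xL yL exy.
have: x \in [set c; y] by rewrite -exy !inE eqxx orbT.
by rewrite !inE => /orP[/eqP xc|/eqP//]; rewrite -xc xL in cL.
Qed.

End StarFactorCount.

Lemma star_factor_decomposition_mod30 (T : finType) (I : {set {set T}})
    (D : {set {set {set T}}}) :
    perfect_matching I -> 3 <= #|T| ->
    star_factor_decomposition 5 (complete_graph T :\: I) D ->
  #|T| = 12 %[mod 30].
Proof.
move=> pI T3 [facD partD].
have cH := card_complete_minus_matching pI.
have sHK : complete_graph T :\: I \subset complete_graph T by exact: subsetDl.
have edges F : F \in D -> 6 * #|F| = 5 * #|T|.
  move=> /facD FH; rewrite (card_star_factor_edges sHK FH).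
  rewrite (card_star_factor_vertices FH); lia.
have cD : 6 * #|complete_graph T :\: I| = #|D| * (5 * #|T|).
  rewrite (card_partition partD) big_distrr /= -sum_nat_const.
  exact: eq_bigr.
(* At least three vertices leave an edge outside the matching, so some factor exists; its component
   count shows that 6 divides the order. *)
have [F FD] : exists F, F \in D.
  apply/set0Pn; rewrite -card_gt0; nia.
have := card_star_factor_vertices (facD F FD).
(* Both counts of the edges carry the factor [#|T|], which cancels. *)
have : 3 * (#|T| - 2) = 5 * #|D| by nia.
lia.
Qed.

(** * Decompositions from centre maps *)

(** The intended [c] sends a point to the centre of its star: fixed points are centres and fibres
    are stars. Values outside [A] are free, so partial factors are covered too. *)
Definition star_on (T : finType) (A : {set T}) (c : T -> T) : Prop :=
  forall y, y \in A ->
    [/\ c y \in A, c (c y) = c y & #|[set z in A | c z == c y]| = 6].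

Section StarMap.

Variables (T : finType) (c : T -> T).
Hypothesis cP : star_on [set: T] c.

Let c_idem y : c (c y) = c y. Proof. by case: (cP (in_setT y)). Qed.

Let card_fibre y : #|[set z | c z == c y]| = 6.
Proof.
by case: (cP (in_setT y)) => _ _ <-; apply: eq_card => z; rewrite !inE.
Qed.

Definition star_edges : {set {set T}} := [set [set y; c y] | y in [set y | c y != y]].

Lemma card_star_leaves : 6 * #|[set y | c y != y]| = 5 * #|T|.
Proof.
have fixT : #|T| = 6 * #|[set y | c y == y]|.
  rewrite -[LHS]sum1_card (partition_big c (fun x => c x == x)) /=; last first.
    by move=> y _; rewrite c_idem.
  rewrite [RHS]mulnC -sum_nat_const; under [RHS]eq_bigl do rewrite inE.
  apply: eq_bigr => x /eqP <-; rewrite sum1dep_card.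
  exact: card_fibre.
have := cardsC [set y | c y == y].
rewrite (_ : ~: _ = [set y | c y != y]); last by apply/setP => y; rewrite !inE.
lia.
Qed.

(** An edge joins a point to its own centre and so stays inside a fibre; conversely each point is at
    most one edge away from its centre. *)
Lemma connect_star_edges x y : connect (adj star_edges) x y = (c x == c y).
Proof.
apply/idP/eqP => [|cxy].
  case/connectP => p; elim: p x => [|z p IHp] x /= => [_ -> //|].
  case/andP=> /imsetP[u _ /setP e] zp yE; rewrite -(IHp z zp yE).
  have:= e x; have:= e z; rewrite !inE !eqxx !orbT /=.
  by move/esym/orP => [] /eqP ->; move/esym/orP => [] => /eqP ->; rewrite ?c_idem.
have toc z : connect (adj star_edges) z (c z).
  have [->|cz] := eqVneq (c z) z; first exact: connect0.
  by apply: connect1; rewrite /adj /=; apply: imset_f; rewrite inE.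
apply: (connect_trans (toc x)); rewrite cxy connect_adj_sym; exact: toc.
Qed.

Lemma star_factor_star_edges (H : {set {set T}}) :
  star_edges \subset H -> star_factor 5 H star_edges.
Proof.
move=> sH; split=> // _ /imsetP[x _ ->].
have -> : [set y | connect (adj star_edges) x y] = [set y | c y == c x].
  by apply/setP => y; rewrite !inE connect_star_edges eq_sym.
exists (c x), ([set y | c y == c x] :\ c x); split.
- by rewrite !inE eqxx.
- have := cardsD1 (c x) [set y | c y == c x].
  by rewrite card_fibre inE c_idem eqxx => - [].
- by rewrite setD1K // inE c_idem.
apply/setP => e; rewrite inE; apply/andP/imsetP => [[]|[y]].
  case/imsetP => y; rewrite inE => cy ->.
  rewrite subUset !sub1set !inE => /andP[/eqP cyx _].
  by exists y; [rewrite !inE cyx eqxx -cyx eq_sym cy | rewrite setUC cyx].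
rewrite !inE => /andP[yc /eqP cyx] ->; split.
  by apply/imsetP; exists y; [rewrite inE cyx eq_sym | rewrite setUC cyx].
by rewrite subUset !sub1set !inE c_idem cyx eqxx.
Qed.

End StarMap.

(* The numbers of edges on both sides agree, so covering every edge already
   forces every edge to be covered once and no edge of [I] to be used. *)
Lemma decomposition_of_star_maps (T Phi : finType) (c : Phi -> T -> T)
    (I : {set {set T}}) :
    perfect_matching I -> 0 < #|T| -> 5 * #|Phi| + 6 = 3 * #|T| ->
    (forall f, star_on [set: T] (c f)) ->
    (forall x y, x != y -> [set x; y] \notin I ->
       exists f, c f x = y \/ c f y = x) ->
  exists D, star_factor_decomposition 5 (complete_graph T :\: I) D.
Proof.
move=> pI T0 cardPhi cP cov; set H := _ :\: I.
have cH := card_complete_minus_matching pI; rewrite -/H in cH.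
(* Pairs of a factor and one of its leaves, one for each use of an edge. *)
pose A := [set fy : Phi * T | c fy.1 fy.2 != fy.2].
pose E (fy : Phi * T) := [set fy.2; c fy.1 fy.2].
have HE : H \subset E @: A.
  apply/subsetP => e; rewrite !inE => /andP[eI /cards2P[x [y [xy def_e]]]].
  rewrite def_e in eI *; have [f [fx|fy]] := cov x y xy eI.
    by apply/imsetP; exists (f, x); rewrite ?inE /= /E /= fx // eq_sym.
  by apply/imsetP; exists (f, y); rewrite ?inE /= /E /= fy // setUC.
have cA : 6 * #|A| = #|Phi| * (5 * #|T|).
  have -> : #|A| = \sum_(f : Phi) #|[set y | c f y != y]|.
    under eq_bigr do rewrite -sum1dep_card.
    rewrite (pair_big_dep xpredT (fun f y => c f y != y) (fun _ _ => 1)) /=.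
    by rewrite -sum1dep_card.
  rewrite big_distrr /= -sum_nat_const.
  by apply: eq_bigr => f _; exact: card_star_leaves.
have AH : #|A| = #|H| by nia.
have EA : E @: A = H.
  by apply/eqP; rewrite eq_sym eqEcard HE -AH leq_imset_card.
(* A surjection between sets of equal size is injective, so no edge is used twice. *)
have Einj : {in A &, injective E} by apply/imset_injP; rewrite EA AH.
have inE' f e : e \in star_edges (c f) -> exists2 y, (f, y) \in A & e = E (f, y).
  by case/imsetP => y cy ->; exists y => //; rewrite inE; rewrite inE in cy.
have sH f : star_edges (c f) \subset H.
  by apply/subsetP => e /inE'[y yA ->]; rewrite -EA imset_f.
exists [set star_edges (c f) | f : Phi]; split.
  by move=> _ /imsetP[f _ ->]; apply: star_factor_star_edges.
apply/and3P; split.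
- rewrite eqEsubset; apply/andP; split.
    by apply/bigcupsP => _ /imsetP[f _ ->].
  rewrite -EA; apply/subsetP => _ /imsetP[[f y] yA ->].
  apply/bigcupP; exists (star_edges (c f)); first exact: imset_f.
  by apply/imsetP; exists y; rewrite ?inE //; rewrite inE in yA.
- apply/trivIsetP => _ _ /imsetP[f _ ->] /imsetP[g _ ->] fg.
  apply/pred0P => e /=; apply/negP => /andP[/inE'[y yA ->] /inE'[z zA /Einj]].
  by move=> /(_ yA zA) [fg' _]; rewrite fg' eqxx in fg.
- apply/negP => /imsetP[f _ /esym/eqP]; apply/negP/set0Pn.
  have: 0 < #|[set y | c f y != y]| by have := card_star_leaves (cP f); lia.
  by case/card_gt0P => y yA; exists [set y; c f y]; apply: imset_f.
Qed.

(** * Cyclic designs on few points *)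

(* A factor is given as a list of stars, each a list of six points beginning with
   its centre. *)
Definition centre (F : seq (seq nat)) (i : nat) : nat :=
  head i (nth [::] F (find (fun s => i \in s) F)).

(** For increasing [pts] the sorted concatenation tests at once that the stars are disjoint and that
    they cover [pts]. *)
Definition star_list (F : seq (seq nat)) (pts : seq nat) : bool :=
  (sort leq (flatten F) == pts) && all (fun s => size s == 6) F.

Definition neighbours (S : seq (seq nat)) (i : nat) : seq nat :=
  flatten [seq if i \in s then
                 if head i s == i then s else [:: head i s]
               else [::] | s <- S].

Definition all_adjacent (D : seq (seq (seq nat))) (X Y : seq nat)
    (ok : rel nat) : bool :=
  all (fun i => let N := neighbours (flatten D) i in
                all (fun j => ok i j || (j \in N)) Y) X.

(* [d] factors, each invariant under the translations by multiples of [d]; the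
   translates of [base] by [m] of them make up a factor. *)
Definition develop (act : nat -> nat -> nat) (d m : nat)
    (base : seq (seq nat)) : seq (seq (seq nat)) :=
  [seq [seq [seq act (r + d * j) i | i <- s] | s <- base, j <- iota 0 m]
     | r <- iota 0 d].

(** The cyclic group of order [n] acts on all blocks of [n] consecutive integers at once. For even
    [n] the element [n / 2] also provides the matching that is left out. *)
Definition shift (n r i : nat) : nat := i %/ n * n + (i %% n + r) %% n.

(** Needed where the stars of one factor have orbits of different lengths and must be developed
    separately. *)
Definition join_factors (D E : seq (seq (seq nat))) : seq (seq (seq nat)) :=
  [seq p.1 ++ p.2 | p <- zip D E].

(* K_{30,30}: the points below 30 are one side. *)
Definition bip_base15 : seq (seq nat) :=
  [:: [:: 57; 1; 25; 8; 10; 13];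
      [:: 38; 2; 15; 4; 29; 22];
      [:: 58; 12; 5; 7; 17; 20];
      [:: 16; 47; 31; 43; 59; 46];
      [:: 3; 35; 55; 51; 41; 36];
      [:: 44; 19; 9; 24; 14; 18];
      [:: 21; 56; 48; 50; 42; 34];
      [:: 28; 53; 52; 49; 30; 32];
      [:: 45; 0; 6; 26; 23; 27];
      [:: 11; 40; 54; 39; 33; 37]].

Definition bip_base3 : seq (seq nat) :=
  [:: [:: 1; 32; 51; 40; 58; 56];
      [:: 30; 16; 5; 27; 23; 3]].

Definition base72 : seq (seq nat) :=
  [:: [:: 24; 5; 70; 18; 27; 36];
      [:: 67; 13; 46; 54; 35; 12];
      [:: 4; 66; 29; 64; 37; 6];
      [:: 63; 52; 14; 65; 11; 10];
      [:: 39; 55; 3; 8; 30; 25];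
      [:: 15; 49; 1; 2; 58; 22];
      [:: 7; 28; 31; 71; 42; 34];
      [:: 19; 40; 44; 23; 20; 48];
      [:: 56; 61; 9; 16; 17; 0];
      [:: 41; 33; 38; 68; 26; 45];
      [:: 43; 57; 62; 51; 50; 69];
      [:: 59; 47; 53; 32; 21; 60]].

Definition base72a : seq (seq nat) :=
  [:: [:: 0; 37; 10; 20; 41; 42]].

Definition base72b : seq (seq nat) :=
  [:: [:: 2; 60; 10; 68; 33; 61]].

(* The points [30 * a + p] form the cell oo, x + g, x - g for a = 0, 1, 2. *)
Definition tri_base0 : seq (seq nat) :=
  [:: [:: 30; 4; 65; 6; 84; 85];
      [:: 45; 3; 20; 64; 25; 87];
      [:: 5; 53; 38; 46; 80; 49]].

Definition tri_base1 : seq (seq nat) :=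
  [:: [:: 10; 56; 76; 45; 42; 31];
      [:: 35; 12; 5; 61; 8; 83];
      [:: 40; 1; 21; 63; 84; 74]].

Definition tri_base2 : seq (seq nat) :=
  [:: [:: 10; 77; 41; 69; 74; 50];
      [:: 60; 13; 52; 30; 2; 33];
      [:: 55; 61; 17; 12; 3; 76]].

(* See [code] for the meaning of the points from 30 on. *)
Definition cyc_base0 : seq (seq nat) :=
  [:: [:: 10; 54; 83; 55; 50; 81]].

Definition cyc_base1 : seq (seq nat) :=
  [:: [:: 20; 82; 83; 43; 33; 72]].

Definition cyc_base2 : seq (seq nat) :=
  [:: [:: 5; 74; 34; 63; 36; 55]].

(* K_42: the points 30, ..., 41 are the twelve points outside the cell. *)
Definition base42 : seq (seq nat) :=
  [:: [:: 14; 39; 11; 41; 22; 8];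
      [:: 21; 12; 17; 16; 5; 15];
      [:: 3; 35; 37; 33; 32; 2];
      [:: 26; 23; 6; 27; 9; 19];
      [:: 31; 18; 4; 29; 13; 10];
      [:: 20; 34; 40; 36; 30; 1];
      [:: 38; 25; 0; 24; 7; 28]].

Definition base42h : seq (seq nat) :=
  [:: [:: 17; 4; 19; 39; 14; 33]].

Definition base30a : seq (seq nat) :=
  [:: [:: 1; 9; 27; 5; 26; 22]].

Definition base30b : seq (seq nat) :=
  [:: [:: 2; 0; 24; 7; 29; 16]].

(** Each element of Z_12 is the centre of one star, with the next five elements as leaves; only the
    difference 6 remains. *)
Definition factors12 := develop (shift 12) 6 2 [:: [:: 0; 1; 2; 3; 4; 5]].

(** The number of factors is 36 + 3 + 3 = 42, which is 3(v - 2)/5 for v = 72. *)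
Definition factors72 :=
  develop (shift 36) 36 1 base72 ++ develop (shift 36) 3 12 base72a ++
  develop (shift 36) 3 12 base72b.

Definition bip_factors :=
  develop (shift 15) 15 1 bip_base15 ++ develop (shift 15) 3 5 bip_base3.

Definition tri_factors :=
  develop (shift 30) 6 5 tri_base0 ++ develop (shift 30) 6 5 tri_base1 ++
  develop (shift 30) 6 5 tri_base2.

Definition cyc_factors :=
  develop (shift 30) 6 5 cyc_base0 ++ develop (shift 30) 6 5 cyc_base1 ++
  develop (shift 30) 6 5 cyc_base2.

(** Z_15 acts with two orbits of length 15 on the cell, and with two orbits of length 5 and two
    fixed points on the twelve further points. *)
Definition shift42 (r i : nat) : nat :=
  if i < 30 then shift 15 r i else if i < 40 then shift 5 r i else i.

(** In the last three factors the stars at the fixed points 40 and 41 are invariant under the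
    multiples of 3, so each is listed once instead of five times. *)
Definition factors42 :=
  develop shift42 15 1 base42 ++
  join_factors (develop shift42 3 5 base42h)
    (develop shift42 3 1 [:: [:: 40; 0; 3; 6; 9; 12]; [:: 41; 15; 18; 21; 24; 27]]).

Definition factors30 :=
  develop (shift 15) 3 5 base30a ++ develop (shift 15) 3 5 base30b.

Lemma factors12P : (size factors12 == 6) &&
  all (fun F => star_list F (iota 0 12)) factors12 &&
  all_adjacent factors12 (iota 0 12) (iota 0 12)
    (fun i j => (i == j) || (j == shift 12 6 i)).
Proof. by vm_compute. Qed.

Lemma factors72P : (size factors72 == 42) &&
  all (fun F => star_list F (iota 0 72)) factors72 &&
  all_adjacent factors72 (iota 0 72) (iota 0 72)
    (fun i j => (i == j) || (j == shift 36 18 i)).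
Proof. by vm_compute. Qed.

Lemma factors42P : (size factors42 == 18) &&
  all (fun F => star_list F (iota 0 42)) factors42 &&
  all_adjacent factors42 (iota 0 30) (iota 30 12) (fun _ _ => false).
Proof. by vm_compute. Qed.

Lemma factors30P : (size factors30 == 6) &&
  all (fun F => star_list F (iota 0 30)) factors30 &&
  all_adjacent (factors42 ++ factors30) (iota 0 30) (iota 0 30)
    (fun i j => (i == j) || (j == shift 30 15 i)).
Proof. by vm_compute. Qed.

Lemma bip_factorsP : (size bip_factors == 18) &&
  all (fun F => star_list F (iota 0 60)) bip_factors &&
  all_adjacent bip_factors (iota 0 30) (iota 30 30) (fun _ _ => false).
Proof. by vm_compute. Qed.

(** A cell y meets the cell oo in two triangles, as x + g for x = y - g and as x - g for x = y + g.
    So each pair of points has to be joined in only one of the two positions. *)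
Lemma tri_factorsP : (size tri_factors == 18) &&
  all (fun F => star_list F (iota 0 90)) tri_factors &&
  all (fun i => let N := neighbours (flatten tri_factors) i in
        all (fun j => (30 + j \in N) || (60 + j \in N)) (iota 0 30)) (iota 0 30).
Proof. by vm_compute. Qed.

Definition reduce30 (F : seq (seq nat)) : seq (seq nat) :=
  [seq [seq i %% 30 | i <- s] | s <- F].

(** The list is to be placed once with every cell as its central cell. Together these copies cover
    each cell once exactly when the residues modulo 30 are all hit once. *)
Definition cyc_star (F : seq (seq nat)) : bool :=
  star_list (reduce30 F) (iota 0 30) &&
  all (fun s => (head 30 s < 30) && all (leq 30) (behead s)) F.

Lemma cyc_factorsP : (size cyc_factors == 18) &&
  all cyc_star cyc_factors.
Proof. by vm_compute. Qed.

(** Point i of x - g and point j of x + g are joined in the triangle, or along the cycle by a star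
    centred at i with a leaf in the next cell, or by one centred at j with a leaf in the previous
    cell. *)
Lemma tri_cycP :
  all (fun i => 
        let N1 := neighbours (flatten tri_factors) (60 + i) in
        let N2 := neighbours (flatten cyc_factors) i in
        let N3 := neighbours (flatten cyc_factors) (60 + i) in
        all (fun j => [|| 30 + j \in N1, 30 + j \in N2 | j \in N3]) (iota 0 30)) (iota 0 30).
Proof. by vm_compute. Qed.

(** * From lists of stars to centre maps *)

Lemma uniq_flatten_eq (T : eqType) (F : seq (seq T)) s s' x :
  uniq (flatten F) -> s \in F -> s' \in F -> x \in s -> x \in s' -> s = s'.
Proof.
elim: F => [|r F IHF] //=; rewrite cat_uniq => /and3P[_ /hasPn rF uF].
have notr t : t \in F -> x \in t -> x \notin r.
  by move=> tF xt; apply: rF; apply/flattenP; exists t.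
rewrite !inE => /predU1P[->|sF] /predU1P[->|s'F] xs xs' //.
- by have := notr _ s'F xs'; rewrite xs.
- by have := notr _ sF xs; rewrite xs'.
- exact: IHF.
Qed.

Lemma centre_star F s i :
  uniq (flatten F) -> s \in F -> i \in s -> centre F i = head i s.
Proof.
move=> uF sF si; rewrite /centre.
have hasF : has (fun s => i \in s) F by apply/hasP; exists s.
by rewrite (uniq_flatten_eq uF (mem_nth _ _) sF (nth_find _ hasF) si) // -has_find.
Qed.

Lemma mem_head_star (T : eqType) (s : seq T) i : i \in s -> head i s \in s.
Proof. by case: s => // a s _; rewrite mem_head. Qed.

Lemma head_irr (T : Type) (s : seq T) x y : 0 < size s -> head x s = head y s.
Proof. by case: s. Qed.

Lemma neighboursP (D : seq (seq (seq nat))) i j :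
    all (fun F => uniq (flatten F)) D -> j \in neighbours (flatten D) i ->
  exists2 F, F \in D & centre F i = j \/ centre F j = i.
Proof.
move=> /allP uD /flattenP[_ /mapP[s /flattenP[F FD sF] ->]].
case: ifP => // si; case: ifP => [/eqP hs js|_].
  exists F => //; right; rewrite (centre_star (uD F FD) sF js) -[RHS]hs.
  by apply: head_irr; case: (s) js.
rewrite inE => /eqP ->; exists F => //; left.
exact: centre_star (uD F FD) sF si.
Qed.

Lemma star_list_flatten F pts :
  star_list F pts -> [/\ uniq pts -> uniq (flatten F), flatten F =i pts
                       & forall s, s \in F -> size s = 6].
Proof.
case/andP=> /eqP <- /allP F6; split; first by rewrite sort_uniq.
  by move=> i; rewrite mem_sort.
by move=> s /F6/eqP.
Qed.

(** The fibre of [c] through a point is the image under [e] of the listed star, whose six entries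
    are distinct. *)
Lemma star_on_list (T : finType) (e : nat -> T) (c : T -> T) F pts :
    uniq pts -> star_list F pts -> {in pts &, injective e} ->
    {in pts, forall i, c (e i) = e (centre F i)} ->
  star_on [set x in map e pts] c.
Proof.
move=> upts /star_list_flatten[/(_ upts) uF eqF F6] einj ec y.
rewrite inE => /mapP[i ip ->].
have [s sF si] := flattenP (etrans (eqF i) ip).
have subp t j : t \in F -> j \in t -> j \in pts.
  by move=> tF jt; rewrite -eqF; apply/flattenP; exists t.
have hs := mem_head_star si.
have ci : centre F i = head i s by exact: centre_star.
have ch : centre F (head i s) = head i s.
  by rewrite (centre_star uF sF hs); apply: head_irr; rewrite F6.
have hp := subp _ _ sF hs.
rewrite (ec _ ip) ci; split.
- by rewrite inE map_f.
- by rewrite (ec _ hp) ch.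
rewrite -(F6 _ sF) -(size_map e).
have us : uniq (map e s).
  rewrite map_inj_in_uniq; last by move=> a b /(subp _ _ sF) ap /(subp _ _ sF); apply: einj.
  move: uF; elim: (F) sF => //= t F' IH; rewrite inE cat_uniq.
  by case/predU1P => [->|sF'] /and3P[] // _ _ /(IH sF').
move/card_uniqP: us => <-; apply: eq_card => z; rewrite !inE.
apply/andP/mapP => [[/mapP[j jp ->]]|[j js ->]].
  have [t tF jt] := flattenP (etrans (eqF j) jp).
  rewrite (ec _ jp) (centre_star uF tF jt) => /eqP /einj eh.
  exists j => //; have ht := mem_head_star jt.
  have := eh (subp _ _ tF ht) hp => eh'; rewrite eh' in ht.
  by rewrite (uniq_flatten_eq uF sF tF hs ht).
have jp := subp _ _ sF js; split; first exact: map_f.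
by rewrite (ec _ jp) (centre_star uF sF js) (head_irr j i) // F6.
Qed.

Lemma eq_star_on (T : finType) (A : {set T}) c c' :
  {in A, c =1 c'} -> star_on A c -> star_on A c'.
Proof.
move=> cc' Ac y yA; have [cA cc fib] := Ac y yA.
rewrite -!cc' //; split=> //; rewrite -fib; apply: eq_card => z.
by rewrite !inE; case zA: (z \in A) => //=; rewrite -cc'.
Qed.

(** The sets [B y] are the blocks of a partition of [A]. As [c] maps each block to itself, points
    with a common centre lie in a common block. *)
Lemma star_on_pieces (T : finType) (A : {set T}) (c : T -> T)
    (B : T -> {set T}) :
    (forall y, y \in A -> [/\ y \in B y, B y \subset A & star_on (B y) c]) ->
    (forall y z, y \in A -> z \in B y -> B z = B y) ->
  star_on A c.
Proof.
move=> AB Beq y yA; have [yB sBA cB] := AB y yA; have [cyB cc fib] := cB y yB.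
split=> //; first exact: (subsetP sBA).
rewrite -fib; apply: eq_card => z; rewrite !inE.
apply/andP/andP => [[zA /eqP czy]|[zB ->]]; last by rewrite (subsetP sBA).
split; last exact/eqP; have [zB sBA' cB'] := AB z zA.
have [cz _ _] := cB' z zB.
by rewrite -(Beq y _ yA cyB) -czy (Beq z _ zA cz).
Qed.

Lemma star_on_image (S T : finType) (h : S -> T) (c : S -> S) (d : T -> T)
    (A : {set S}) :
    injective h -> {in A, forall x, d (h x) = h (c x)} -> star_on A c ->
  star_on (h @: A) d.
Proof.
move=> hinj dh Ac _ /imsetP[x xA ->]; have [cA cc fib] := Ac x xA.
rewrite !dh // cc; split=> //; first exact: imset_f.
rewrite -fib -(card_imset _ hinj); apply: eq_card => z; rewrite inE.
apply/andP/imsetP => [[/imsetP[u uA ->]]|[u]].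
  by rewrite dh // => /eqP/hinj cu; exists u; rewrite // inE uA cu /=.
by rewrite inE => /andP[uA /eqP cu] ->; rewrite imset_f // dh // cu.
Qed.

(* A point [30 * d + p] of a factor of [cyc_factors] stands for the point [p] of
   the next cell (d = 1) or of the previous cell (d = 2) relative to the
   centre of its star (d = 0). *)
Definition code (F : seq (seq nat)) (p : nat) : nat :=
  nth 0 (flatten F) (find (fun i => i %% 30 == p) (flatten F)).

Section Code.

Variable F : seq (seq nat).
Hypothesis FP : cyc_star F.

Lemma flatten_reduce30 : flatten (reduce30 F) = [seq i %% 30 | i <- flatten F].
Proof. by rewrite map_flatten. Qed.

Lemma uniq_mod30 : uniq [seq i %% 30 | i <- flatten F].
Proof.
rewrite -flatten_reduce30; case/andP: FP => /star_list_flatten[uF _ _] _.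
exact/uF/iota_uniq.
Qed.

Lemma code_mod i : i \in flatten F -> code F (i %% 30) = i.
Proof.
move=> iF; rewrite /code.
(* The residues in the list are distinct, so searching by residue finds [i] itself. *)
have -> : find (fun j => j %% 30 == i %% 30) (flatten F) = index i (flatten F).
  have := uniq_mod30; elim: (flatten F) iF => [//|j l IHl] /=.
  rewrite inE => /predU1P[->|il] /andP[jl ul]; first by rewrite !eqxx.
  have [ji|ne] := eqVneq j i.
    by case/negP: jl; rewrite ji; apply/mapP; exists i.
  rewrite IHl // ifN //; apply: contra jl => /eqP ->.
  by apply/mapP; exists i.
by rewrite nth_index.
Qed.

Lemma codeP p : p < 30 -> exists2 s, s \in F & code F p \in s.
Proof.
move=> p30; apply/flattenP.
have : p \in [seq i %% 30 | i <- flatten F].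
  rewrite -flatten_reduce30; case/andP: FP => /star_list_flatten[_ -> _] _.
  by rewrite mem_iota.
by case/mapP => i iF ->; rewrite code_mod.
Qed.

Lemma code_modK p : p < 30 -> code F p %% 30 = p.
Proof.
move=> p30.
have : p \in [seq i %% 30 | i <- flatten F].
  rewrite -flatten_reduce30; case/andP: FP => /star_list_flatten[_ -> _] _.
  by rewrite mem_iota.
by case/mapP => i iF ->; rewrite code_mod.
Qed.

Lemma uniq_flatten_cyc : uniq (flatten F).
Proof. exact: map_uniq uniq_mod30. Qed.

Lemma cyc_head s i : s \in F -> i \in s -> head i s < 30.
Proof.
by case/andP: FP => _ /allP H /H; case: s => //= a s /andP[].
Qed.

(** Centres are below 30 and are fixed by reduction modulo 30, hence passing to the centre commutes
    with the reduction. *)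
Lemma code_centre p : p < 30 ->
  [/\ centre F (code F p) < 30, code F (centre F (code F p)) = centre F (code F p)
    & centre (reduce30 F) p = centre F (code F p)].
Proof.
move=> p30; have [s sF cs] := codeP p30.
rewrite (centre_star uniq_flatten_cyc sF cs).
have h30 := cyc_head sF cs; have hs := mem_head_star cs; split=> //.
  rewrite -{1}(modn_small h30) code_mod //.
  by apply/flattenP; exists s.
have uF : uniq (flatten (reduce30 F)) by rewrite flatten_reduce30 uniq_mod30.
rewrite (centre_star (s := [seq i %% 30 | i <- s]) uF).
- by case: (s) hs h30 cs => //= a l _ h30 _; rewrite modn_small.
- exact: map_f.
by apply/mapP; exists (code F p); rewrite ?code_modK.
Qed.

(** The default values of [nth] and [head] make a point absent from the list its own centre. *)
Lemma centre_notin i : i \notin flatten F -> centre F i = i.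
Proof.
move=> iF; rewrite /centre hasNfind ?nth_default //.
by apply/hasPn => s sF; apply: contra iF => si; apply/flattenP; exists s.
Qed.

Lemma centre_small i : i < 30 -> centre F i < 30.
Proof.
have [/flattenP[s sF si] _|/centre_notin->//] := boolP (i \in flatten F).
by rewrite (centre_star uniq_flatten_cyc sF si) (cyc_head sF si).
Qed.

End Code.

Definition linked (F : seq (seq nat)) (i j : nat) : Prop :=
  centre F i = j \/ centre F j = i.

Lemma linked_sym F i j : linked F i j -> linked F j i.
Proof. by case; [right | left]. Qed.

Definition factor (r : nat) (D : seq (seq (seq nat))) (k : 'I_r) : seq (seq nat) :=
  nth [::] D k.

Lemma factor_all (r : nat) (P : pred (seq (seq nat))) D (k : 'I_r) :
  size D == r -> all P D -> P (factor D k).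
Proof. by move=> /eqP sD /all_nthP; apply; rewrite sD. Qed.

Lemma all_star_list_uniq D n :
  all (fun F => star_list F (iota 0 n)) D -> all (fun F => uniq (flatten F)) D.
Proof.
by apply: sub_all => F /star_list_flatten[uF _ _]; apply/uF/iota_uniq.
Qed.

Lemma neighbours_factor r D i j :
    size D == r -> all (fun F => uniq (flatten F)) D ->
    j \in neighbours (flatten D) i ->
  exists k : 'I_r, linked (factor D k) i j.
Proof.
move=> /eqP sD uD /(neighboursP uD)[F FD Fij].
have k_r : index F D < r by rewrite -sD index_mem.
by exists (Ordinal k_r); rewrite /factor nth_index.
Qed.

Lemma all_adjacent_factor r D X Y ok i j :
    size D == r -> all (fun F => uniq (flatten F)) D -> all_adjacent D X Y ok ->
    i \in X -> j \in Y -> ~~ ok i j ->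
  exists k : 'I_r, linked (factor D k) i j.
Proof.
move=> sD uD /allP adjD /adjD /allP adji /adji /orP[->//|ij] _.
exact: neighbours_factor ij.
Qed.

(** The centre of a point below 30 is below 30, so in a link between [i] and [j] the centre must be
    [i]. Then [j] is not its own centre and must occur in the list. *)
Lemma cyc_neighbours r D (i j : nat) :
    size D == r -> all cyc_star D -> i < 30 -> 30 <= j ->
    (j \in neighbours (flatten D) i) || (i \in neighbours (flatten D) j) ->
  exists k : 'I_r, centre (factor D k) j = i /\ code (factor D k) (j %% 30) = j.
Proof.
move=> sD sl i30 j30 H.
have uD : all (fun F => uniq (flatten F)) D.
  by apply: sub_all sl => F; apply: uniq_flatten_cyc.
have [k E] : exists k : 'I_r, linked (factor D k) i j.
  by case/orP: H => /(neighbours_factor sD uD)[k E]; exists k => //; apply: linked_sym.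
have FP : cyc_star (factor D k) by exact: factor_all.
have Ej : centre (factor D k) j = i.
  by case: E => // E; have := centre_small FP i30; rewrite E ltnNge j30.
exists k; split=> //; apply: (code_mod FP); apply: contraLR i30 => /centre_notin.
by rewrite Ej => ->; rewrite -leqNgt.
Qed.

Lemma checked_factor r D n (b : bool) (k : 'I_r) :
  (size D == r) && all (fun F => star_list F (iota 0 n)) D && b ->
  star_list (factor D k) (iota 0 n).
Proof. by case/andP => /andP[sD sl] _; apply: factor_all sD sl. Qed.

Lemma checked_linked r D n X Y ok i j :
    (size D == r) && all (fun F => star_list F (iota 0 n)) D && all_adjacent D X Y ok ->
    i \in X -> j \in Y -> ~~ ok i j ->
  exists k : 'I_r, linked (factor D k) i j.
Proof.
case/andP => /andP[sD sl]; apply: all_adjacent_factor sD _.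
exact: all_star_list_uniq sl.
Qed.

Lemma ord_iota m n (i : 'I_n) : m + i \in iota m n.
Proof. by rewrite mem_iota leq_addr ltn_add2l ltn_ord. Qed.

(** The existential form, here and for the other small designs, hides the explicit lists from the
    later arguments. *)
Lemma bip_gadget : exists B : 'I_18 -> seq (seq nat),
  (forall k, star_list (B k) (iota 0 60)) /\
  (forall p q : 'I_30, exists k, linked (B k) p (30 + q)).
Proof.
exists (factor bip_factors); split=> [k|p q].
  exact: checked_factor bip_factorsP.
exact: (checked_linked bip_factorsP (ord_iota 0 p) (ord_iota 30 q)).
Qed.

Lemma factors72_exist : exists P : 'I_42 -> seq (seq nat),
  (forall k, star_list (P k) (iota 0 72)) /\
  (forall x y : 'I_72, x != y -> y != shift 36 18 x :> nat ->
     exists k, linked (P k) x y).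
Proof.
exists (factor factors72); split=> [k|x y xy ym].
  exact: checked_factor factors72P.
apply: (checked_linked factors72P (ord_iota 0 x) (ord_iota 0 y)).
by rewrite negb_or xy.
Qed.

Lemma tri_cyc_gadget : exists R C : 'I_18 -> seq (seq nat),
  [/\ forall k, star_list (R k) (iota 0 90),
      forall p q : 'I_30,
        exists k, linked (R k) p (30 + q) \/ linked (R k) p (60 + q),
      forall k, cyc_star (C k)
    & forall p q : 'I_30, exists k,
        [\/ linked (R k) (60 + p) (30 + q),
            centre (C k) (30 + q) = p /\ code (C k) ((30 + q) %% 30) = (30 + q)%N
          | centre (C k) (60 + p) = q /\ code (C k) ((60 + p) %% 30) = (60 + p)%N]].
Proof.
exists (factor tri_factors), (factor cyc_factors); split.
- by move=> k; exact: checked_factor tri_factorsP.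
- move=> p q.
  have /orP[] : (30 + q \in neighbours (flatten tri_factors) p) ||
                (60 + q \in neighbours (flatten tri_factors) p).
    case/andP: tri_factorsP => _ /allP/(_ p (ord_iota 0 p))/allP.
    exact: (fun H => H q (ord_iota 0 q)).
  + case/andP: tri_factorsP => /andP[sz sl] _.
    case/(neighbours_factor sz (all_star_list_uniq sl)) => k E.
    exists k; left; exact: E.
  case/andP: tri_factorsP => /andP[sz sl] _.
  case/(neighbours_factor sz (all_star_list_uniq sl)) => k E.
  exists k; right; exact: E.
- by move=> k; case/andP: cyc_factorsP => sz sl; exact: (factor_all k sz sl).
move=> p q.
have /or3P[] : [|| 30 + q \in neighbours (flatten tri_factors) (60 + p),
                   30 + q \in neighbours (flatten cyc_factors) p
                 | (q : nat) \in neighbours (flatten cyc_factors) (60 + p)].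
    have /allP/(_ p (ord_iota 0 p))/allP := tri_cycP.
    exact: (fun H => H q (ord_iota 0 q)).
- case/andP: tri_factorsP => /andP[sz sl] _.
  case/(neighbours_factor sz (all_star_list_uniq sl)) => k E.
  exists k; apply: Or31; exact: E.
- move=> H; case/andP: cyc_factorsP => sz sl.
  have H' : (30 + q \in neighbours (flatten cyc_factors) p) ||
            (val p \in neighbours (flatten cyc_factors) (30 + q)).
    by rewrite H.
  have [k E] := cyc_neighbours sz sl (ltn_ord p) (leq_addr q 30) H'.
  exists k; apply: Or32; exact: E.
move=> H; case/andP: cyc_factorsP => sz sl.
have H' : (60 + p \in neighbours (flatten cyc_factors) q) ||
          (val q \in neighbours (flatten cyc_factors) (60 + p)).
  by rewrite H orbT.
have p60 : 30 <= 60 + p by exact: leq_trans (leq_addr p 60).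
have [k E] := cyc_neighbours sz sl (ltn_ord q) p60 H'.
exists k; apply: Or33; exact: E.
Qed.

Lemma fill_gadget : exists (P12 P30 : 'I_6 -> seq (seq nat)) (P42 : 'I_18 -> seq (seq nat)),
  [/\ [/\ forall k, star_list (P12 k) (iota 0 12),
          forall k, star_list (P30 k) (iota 0 30)
        & forall k, star_list (P42 k) (iota 0 42)],
      forall h h' : 'I_12, h != h' -> h' != shift 12 6 h :> nat ->
        exists k, linked (P12 k) h h',
      forall p q : 'I_30, p != q -> q != shift 30 15 p :> nat ->
        (exists k, linked (P42 k) p q) \/ (exists k, linked (P30 k) p q)
    & forall (p : 'I_30) (h : 'I_12), exists k, linked (P42 k) p (30 + h)].
Proof.
exists (factor factors12), (factor factors30), (factor factors42); split.
- split=> k.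
  + exact: checked_factor factors12P.
  + exact: checked_factor factors30P.
  + exact: checked_factor factors42P.
- move=> h h' hh hm; apply: (checked_linked factors12P (ord_iota 0 h) (ord_iota 0 h')).
  by rewrite negb_or hh.
- move=> p q pq pm; have ok : ~~ ((p == q :> nat) || (q == shift 30 15 p :> nat)).
    by rewrite negb_or pq.
  have : (q : nat) \in neighbours (flatten (factors42 ++ factors30)) p.
    case/andP: factors30P => _ /allP/(_ p (ord_iota 0 p))/allP.
    move=> H; have := H q (ord_iota 0 q); rewrite (negPf ok); exact: id.
  rewrite /neighbours flatten_cat map_cat flatten_cat mem_cat -!/(neighbours _ _).
  case/orP.
    case/andP: factors42P => /andP[sz sl] _.
    case/(neighbours_factor sz (all_star_list_uniq sl)) => k E.
    left; exists k; exact: E.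
  case/andP: factors30P => /andP[sz sl] _.
  case/(neighbours_factor sz (all_star_list_uniq sl)) => k E.
  right; exists k; exact: E.
move=> p h; exact: (checked_linked factors42P (ord_iota 0 p) (ord_iota 30 h)).
Qed.

(** * Frames *)

Lemma star_list_centre F n i :
  star_list F (iota 0 n) -> i < n -> centre F i < n.
Proof.
case/star_list_flatten => /(_ (iota_uniq 0 n)) uF eqF _ i_n.
have [s sF si] : exists2 s, s \in F & i \in s.
  by apply/flattenP; rewrite eqF mem_iota.
rewrite (centre_star uF sF si).
have : head i s \in flatten F by apply/flattenP; exists s => //; apply: mem_head_star.
by rewrite eqF mem_iota.
Qed.

Section Spread.

Variable X : finType.

Definition point (x0 : X) (cs : seq X) (i : nat) : X * 'I_30 :=
  (nth x0 cs (i %/ 30), inord (i %% 30)).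

(* The cell [nth x0 cs a] carries the points [30 * a], ..., [30 * a + 29] of
   the list of stars [F]. *)
Definition spread (cs : seq X) (F : seq (seq nat)) (z : X * 'I_30) : X * 'I_30 :=
  point z.1 cs (centre F (30 * index z.1 cs + z.2)).

Lemma star_on_spread cs F :
    uniq cs -> star_list F (iota 0 (30 * size cs)) ->
  star_on [set z | z.1 \in cs] (spread cs F).
Proof.
move=> ucs FP [x0 p0]; move: (x0, p0).
have lt_size i : i \in iota 0 (30 * size cs) -> i %/ 30 < size cs.
  rewrite mem_iota; lia.
have -> : [set z : X * 'I_30 | z.1 \in cs]
        = [set z in map (point x0 cs) (iota 0 (30 * size cs))].
  apply/setP => -[y p]; rewrite !inE /=; apply/idP/mapP => [ycs|[i /lt_size ip [-> _]]].
    exists (30 * index y cs + p).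
      rewrite -index_mem in ycs;
      move: ycs; move: (index y cs) (size cs) => a b ab.
      by have := ltn_ord p; rewrite mem_iota; lia.
    rewrite /point mulnC divnMDl // divn_small // addn0 nth_index //.
    by rewrite modnMDl modn_small // inord_val.
  exact: mem_nth.
apply: (star_on_list (F := F) (iota_uniq 0 (30 * size cs))) => //.
- move=> i j ip jp [/eqP]; rewrite nth_uniq ?lt_size // => /eqP eij.
  move=> /(congr1 val) /=; rewrite !inordK ?ltn_mod // => mij.
  by rewrite (divn_eq i 30) eij mij -divn_eq.
- move=> i ip; have ci : centre F i < 30 * size cs.
    by apply: star_list_centre FP _; rewrite mem_iota in ip.
  rewrite /spread /= index_uniq ?lt_size // inordK ?ltn_mod // mulnC -divn_eq.
  by congr pair; apply: set_nth_default; rewrite ltn_divLR // mulnC.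
Qed.

Lemma spread_eq (x0 : X) cs F a b (p q : 'I_30) :
    uniq cs -> a < size cs -> b < size cs ->
    centre F (30 * a + p) = 30 * b + q ->
  spread cs F (nth x0 cs a, p) = (nth x0 cs b, q).
Proof.
move=> ucs ha hb ce; rewrite /spread /= index_uniq // ce /point.
rewrite mulnC divnMDl // divn_small // addn0 modnMDl modn_small // inord_val.
by congr pair; apply: set_nth_default.
Qed.

End Spread.

(* [fr x k] for [k < 18] are the partial star factors missing the cell [x]. *)
Definition is_frame (X : finType) (fr : X -> 'I_18 -> X * 'I_30 -> X * 'I_30) : Prop :=
  (forall x k, star_on [set z | z.1 != x] (fr x k)) /\
  (forall y z (p q : 'I_30), y != z ->
     exists x k, [/\ x != y, x != z & fr x k (y, p) = (z, q) \/ fr x k (z, q) = (y, p)]).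

(** * Frames on an odd number of cells *)

Section Frames.

Import GRing.Theory.
Local Open Scope ring_scope.

Variables (A : finZmodType) (B : 'I_18 -> seq (seq nat)).
Hypothesis bip_star : forall k, star_list (B k) (iota 0 60).
Hypothesis bip_cover : forall p q : 'I_30, exists k, linked (B k) p (30 + q).
Hypothesis odd_A : forall a : A, a + a = 0 -> a = 0.

Let double_inj : injective (fun a : A => a + a).
Proof.
move=> a b /eqP; rewrite -subr_eq0 opprD addrACA => /eqP/odd_A/eqP.
by rewrite subr_eq0 => /eqP.
Qed.

Definition mirror (x y : A) : A := x + x - y.

Lemma mirrorK x : involutive (mirror x).
Proof. by move=> y; rewrite /mirror opprB addrC subrK. Qed.

Lemma mirror_neq x y : y != x -> mirror x y != y.
Proof.
move=> yx; apply: contra yx => /eqP; rewrite /mirror => /eqP.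
by rewrite subr_eq => /eqP/double_inj ->.
Qed.

(** Doubling is a bijection, so y + z can be halved; the half is the hole for which the cells y and
    z are paired. *)
Lemma midpoint (y z : A) : y != z -> exists x, [/\ x != y, x != z & z = mirror x y].
Proof.
move=> yz; exists (invF double_inj (y + z)).
have := f_invF double_inj (y + z); set x := invF _ _ => /= xx.
have zE : z = mirror x y by rewrite /mirror xx addrC addKr.
split=> //; apply: contra yz => /eqP xE; rewrite {}xE in xx zE.
  by rewrite zE /mirror addrK.
by rewrite -(inj_eq (addIr z)) xx.
Qed.

(** The order by rank makes the list the same for [y] and its mirror image, so both cells use the
    same orientation of the bipartite design. *)
Definition pair_cells (x y : A) : seq A :=
  if (enum_rank y < enum_rank (mirror x y))%N then [:: y; mirror x y]
  else [:: mirror x y; y].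

Lemma mem_pair_cells x y z : (z \in pair_cells x y) = (z == y) || (z == mirror x y).
Proof. by rewrite /pair_cells; case: ifP; rewrite !inE // orbC. Qed.

Lemma uniq_pair_cells x y : y != x -> uniq (pair_cells x y).
Proof.
move=> /mirror_neq yx; rewrite /pair_cells.
by case: ifP => _ /=; rewrite inE ?yx // eq_sym yx.
Qed.

Lemma size_pair_cells x y : size (pair_cells x y) = 2%N.
Proof. by rewrite /pair_cells; case: ifP. Qed.

Lemma pair_cells_mirror x y : y != x -> pair_cells x (mirror x y) = pair_cells x y.
Proof.
move=> yx; rewrite /pair_cells mirrorK; have := mirror_neq yx.
rewrite -(inj_eq enum_rank_inj) neq_ltn => /orP[] lt.
  by rewrite lt ltnNge ltnW.
by rewrite lt ltnNge ltnW.
Qed.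

Lemma mirror_fix x y : (mirror x y == x) = (y == x).
Proof. by rewrite /mirror subr_eq (inj_eq (addrI x)) eq_sym. Qed.

Lemma pair_cover (y z : A) (p q : 'I_30) x : y != x -> z = mirror x y ->
  exists k : 'I_18, spread (pair_cells x y) (B k) (y, p) = (z, q)
    \/ spread (pair_cells x y) (B k) (z, q) = (y, p).
Proof.
move=> yx ->; have := uniq_pair_cells yx; rewrite /pair_cells; case: ifP => _ u.
  have [k [E|E]] := bip_cover p q; exists k; [left|right].
    by apply: (spread_eq (a := 0) (b := 1) y u).
  by apply: (spread_eq (a := 1) (b := 0) y u).
have [k [E|E]] := bip_cover q p; exists k; [right|left].
  by apply: (spread_eq (a := 0) (b := 1) y u).
by apply: (spread_eq (a := 1) (b := 0) y u).
Qed.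

Definition odd_frame (x : A) (k : 'I_18) (z : A * 'I_30) : A * 'I_30 :=
  spread (pair_cells x z.1) (B k) z.

Lemma odd_frameP : is_frame odd_frame.
Proof.
split=> [x k|y z p q yz]; last first.
  have [x [xy xz zE]] := midpoint yz.
  have yx : y != x by rewrite eq_sym.
  have [k] := pair_cover p q yx zE.
  exists x, k; split=> //; rewrite /odd_frame /=.
by have -> : pair_cells x z = pair_cells x y by rewrite zE pair_cells_mirror.
apply: (star_on_pieces (B := fun z => [set w | w.1 \in pair_cells x z.1])).
  move=> [y p]; rewrite inE /= => yx; split.
  - by rewrite inE mem_pair_cells eqxx.
  - apply/subsetP => -[w r]; rewrite !inE mem_pair_cells /=.
    by case/orP => /eqP ->; rewrite ?mirror_fix.
  apply: (@eq_star_on _ _ (spread (pair_cells x y) (B k))).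
    move=> [w r]; rewrite inE mem_pair_cells /odd_frame /= => /orP[]/eqP -> //.
    by rewrite pair_cells_mirror.
  apply: star_on_spread; first exact: uniq_pair_cells.
  by rewrite size_pair_cells; exact: bip_star.
move=> [y p] [z q]; rewrite !inE mem_pair_cells /= => yx /orP[]/eqP -> //.
by rewrite pair_cells_mirror.
Qed.

End Frames.

(** Lifting stars along the projection to [P]: since each [tau p] is a bijection, trivial at
    centres, every fibre upstairs maps bijectively onto a fibre of [b]. *)
Lemma star_on_cover (Y P : finType) (b : P -> P) (tau tau' : P -> Y -> Y) :
    star_on [set: P] b -> (forall p, cancel (tau p) (tau' p)) ->
    (forall p, cancel (tau' p) (tau p)) -> (forall p, tau (b p) =1 id) ->
  star_on [set: Y * P] (fun z => (tau z.2 z.1, b z.2)).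
Proof.
move=> bP tauK tauK' tau_b [y p] _ /=.
have [_ bb fib] := bP p (in_setT p).
split=> /=; [by rewrite inE | by rewrite tau_b bb |].
rewrite -fib -(card_imset (f := fun p' => (tau' p' (tau p y), p'))); last by move=> ? ? [].
apply: eq_card => -[y' p']; rewrite !inE /=; apply/eqP/imsetP => [[<- bpp]|[p1]].
  by exists p'; rewrite ?inE ?bpp ?tauK /=.
by rewrite !inE /= => /eqP bpp [-> ->]; rewrite tauK' bpp.
Qed.

Lemma spread_map (X Y : finType) (h : X -> Y) cs F y (p : 'I_30) :
    injective h ->
  spread (map h cs) F (h y, p) =
    (h (spread cs F (y, p)).1, (spread cs F (y, p)).2).
Proof.
move=> hinj; rewrite /spread /point /= index_map //.
set i := _ %/ 30; congr pair; have [i_cs|cs_i] := ltnP i (size cs).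
  exact: nth_map.
by rewrite !nth_default // size_map.
Qed.

(** * Frames on an even number of cells *)

Section EvenFrame.

Import GRing.Theory.
Local Open Scope ring_scope.

Variables (A : finZmodType) (g : A) (B R C : 'I_18 -> seq (seq nat)).
Hypothesis bip_star : forall k, star_list (B k) (iota 0 60).
Hypothesis bip_cover : forall p q : 'I_30, exists k, linked (B k) p (30 + q).
Hypothesis tri_star : forall k, star_list (R k) (iota 0 90).
Hypothesis tri_cover : forall p q : 'I_30,
  exists k, linked (R k) p (30 + q) \/ linked (R k) p (60 + q).
Hypothesis cyc_starP : forall k, cyc_star (C k).
Hypothesis tri_cyc_cover : forall p q : 'I_30, exists k,
  [\/ linked (R k) (60 + p) (30 + q),
      centre (C k) (30 + q) = p /\ code (C k) ((30 + q) %% 30) = (30 + q)%N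
    | centre (C k) (60 + p) = q /\ code (C k) ((60 + p) %% 30) = (60 + p)%N].
Hypothesis odd_A : forall a : A, a + a = 0 -> a = 0.
Hypothesis g_neq0 : g != 0.

(** The cells x - g and x + g differ by [g + g], so the pairs left over by the triangles form the
    cycles y, y + step, y + 2 step, and so on. *)
Let step : A := g + g.

Definition cyc_shift (d : nat) : A := match d with 0 => 0 | 1 => step | _ => - step end.

Definition cyc_map (k : 'I_18) (z : A * 'I_30) : A * 'I_30 :=
  let F := C k in
  (z.1 - cyc_shift (code F z.2 %/ 30), inord (centre F (code F z.2))).

(** Forgetting the cells gives the reduced list, a star factor on 30 points. The cells are restored
    by translations, which are trivial at centres because centres have codes below 30. *)
Lemma cyc_map_star k : star_on [set: A * 'I_30] (cyc_map k).
Proof.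
set F := C k; have FP : cyc_star F := cyc_starP k.
pose b (p : 'I_30) : 'I_30 := inord (centre F (code F p)).
have bE (p : 'I_30) : b p = centre F (code F p) :> nat.
  by rewrite inordK //; have [] := code_centre FP (ltn_ord p).
apply: (star_on_cover (b := b) (tau := fun p y => y - cyc_shift (code F p %/ 30))
                (tau' := fun p y => y + cyc_shift (code F p %/ 30))).
- have -> : [set: 'I_30] = [set p in map inord (iota 0 30)].
    apply/setP => p; rewrite in_setT [RHS]in_set; apply/esym; apply/mapP.
    by exists (val p); rewrite ?inord_val // mem_iota ltn_ord.
  apply: (star_on_list (F := reduce30 F)); first exact: iota_uniq.
  + by case/andP: FP.
  + by move=> i j; rewrite !mem_iota /= => ip jp /(congr1 val); rewrite /= !inordK.
  + move=> i; rewrite mem_iota /= => ip; rewrite /b inordK //.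
    by have [_ _ ->] := code_centre FP ip.
- by move=> p y; rewrite subrK.
- by move=> p y; rewrite addrK.
move=> p y; rewrite bE; have [c30 -> _] := code_centre FP (ltn_ord p).
by rewrite divn_small // subr0.
Qed.

Definition near_centre (x y : A) : bool := (y == x + g) || (y == x - g).

Definition tri_cells (x : A) : seq (option A) := [:: None; Some (x + g); Some (x - g)].

(** For the hole [x] the remaining cells split into one triangle and mirror pairs; the value is the
    block of [y]. *)
Definition even_cells (x : A) (y : option A) : seq (option A) :=
  if y is Some y' then
    if near_centre x y' then tri_cells x else map Some (pair_cells x y')
  else tri_cells x.

(** The length of the block tells a pair from the triangle. For the hole [None] the value on its own
    cell is arbitrary. *)
Definition even_frame (x : option A) (k : 'I_18) (z : option A * 'I_30) :
    option A * 'I_30 :=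
  match x, z.1 with
  | Some x', _ =>
    let cs := even_cells x' z.1 in
    spread cs (if size cs == 2 then B k else R k) z
  | None, Some y => let w := cyc_map k (y, z.2) in (Some w.1, w.2)
  | None, None => z
  end.


Lemma near_mirror x y : near_centre x (mirror x y) = near_centre x y.
Proof.
have e : mirror x (x + g) = x - g by rewrite /mirror opprD addrA addrK.
rewrite /near_centre (inv_eq (mirrorK x)) e orbC; congr (_ || _).
by rewrite (inv_eq (mirrorK x)) -e mirrorK.
Qed.

Lemma uniq_tri_cells x : uniq (tri_cells x).
Proof.
rewrite /tri_cells /= inE andbT; apply: contra g_neq0 => /eqP[/addrI gg].
by apply/eqP/odd_A; rewrite {1}gg addNr.
Qed.

Lemma mem_tri_cells x y : (Some y \in tri_cells x) = near_centre x y.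
Proof. by rewrite !inE. Qed.

Lemma near_centreN x : near_centre x x = false.
Proof.
rewrite /near_centre -{1 3}[x]addr0 !(inj_eq (addrI x)).
by rewrite !(eq_sym 0) oppr_eq0 (negPf g_neq0).
Qed.

Lemma even_cells_self x y : y \in even_cells x y.
Proof.
case: y => [y|] //=; case: ifP => yx; first by rewrite mem_tri_cells.
by rewrite mem_map ?mem_pair_cells ?eqxx // => ? ? [].
Qed.

Lemma even_cells_hole x y : y != Some x -> Some x \notin even_cells x y.
Proof.
case: y => [y|] yx /=; last by rewrite mem_tri_cells near_centreN.
case: ifP => _; first by rewrite mem_tri_cells near_centreN.
rewrite mem_map; last by move=> ? ? [].
rewrite mem_pair_cells negb_or eq_sym (eq_sym x) mirror_fix andbb.
by apply: contra yx => /eqP ->.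
Qed.

Lemma even_cells_eq x y z :
  y != Some x -> z \in even_cells x y -> even_cells x z = even_cells x y.
Proof.
have tri : z \in tri_cells x -> even_cells x z = tri_cells x.
  by case: z => [z|] //=; rewrite mem_tri_cells => ->.
case: y => [y|] yx //=; case: ifP => // near /mapP[w].
rewrite mem_pair_cells => /orP[] /eqP -> -> /=; rewrite ?near_mirror near //.
by rewrite pair_cells_mirror.
Qed.

Lemma even_cells_star x y (k : 'I_18) : y != Some x ->
  let cs := even_cells x y in
  star_on [set z | z.1 \in cs]
    (spread cs (if size cs == 2 then B k else R k)).
Proof.
have tri : star_on [set z | z.1 \in tri_cells x]
    (spread (tri_cells x) (R k)).
  by apply: star_on_spread; [exact: uniq_tri_cells | exact: tri_star].
case: y => [y|] yx //=; case: ifP => // near.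
rewrite size_map size_pair_cells /=; apply: star_on_spread.
  by rewrite map_inj_uniq ?uniq_pair_cells // => ? ? [].
by rewrite size_map size_pair_cells; exact: bip_star.
Qed.

Lemma even_frame_star x k : star_on [set z | z.1 != x] (even_frame x k).
Proof.
case: x => [x|].
  apply: (star_on_pieces (B := fun z => [set w | w.1 \in even_cells x z.1])).
    move=> [y p]; rewrite inE /= => yx; split.
    - by rewrite inE even_cells_self.
    - apply/subsetP => -[w r]; rewrite !inE /= => wy.
      by apply: contraL wy => /eqP ->; apply: even_cells_hole.
    have := even_cells_star k yx; apply: eq_star_on => -[w r]; rewrite inE /= => wy.
    by rewrite (even_cells_eq yx wy).
  move=> [y p] [z q]; rewrite !inE /= => yx zy.
  by rewrite (even_cells_eq yx zy).
have -> : [set z : option A * 'I_30 | z.1 != None]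
        = (fun w : A * 'I_30 => (Some w.1, w.2)) @: [set: A * 'I_30].
  apply/setP => -[[y|] p]; rewrite !inE /=; apply/esym.
    by apply/imsetP; exists (y, p); rewrite ?inE.
  by apply/imsetP => -[].
apply: star_on_image (cyc_map_star k); first by move=> [? ?] [? ?] [-> ->].
by case=> ? ?.
Qed.

(** The hole is y - g when the pair is joined in position 1 of the triangle and y + g when it is
    joined in position 2. *)
Lemma even_cover_inf y (p q : 'I_30) : exists x k, [/\ x != None, x != Some y
  & even_frame x k (None, p) = (Some y, q) \/ even_frame x k (Some y, q) = (None, p)].
Proof.
have [k [E|E]] := tri_cover p q.
  exists (Some (y - g)), k; split=> //.
    by apply: contra g_neq0 => /eqP[/eqP]; rewrite -subr_eq0 addrC addKr oppr_eq0.
  have near : near_centre (y - g) y by rewrite /near_centre subrK eqxx.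
  have yE : Some y = nth None (tri_cells (y - g)) 1 by rewrite /= subrK.
  have u := uniq_tri_cells (y - g).
  case: E => E; [left|right]; rewrite /even_frame /= ?near /=.
    by rewrite yE; apply: (spread_eq (a := 0) (b := 1) None u).
  by rewrite yE; apply: (spread_eq (a := 1) (b := 0) None u).
exists (Some (y + g)), k; split=> //.
  by apply: contra g_neq0 => /eqP[/eqP]; rewrite -subr_eq0 addrC addKr.
have near : near_centre (y + g) y by rewrite /near_centre addrK eqxx orbT.
have yE : Some y = nth None (tri_cells (y + g)) 2 by rewrite /= addrK.
have u := uniq_tri_cells (y + g).
case: E => E; [left|right]; rewrite /even_frame /= ?near /=.
  by rewrite yE; apply: (spread_eq (a := 0) (b := 2) None u).
by rewrite yE; apply: (spread_eq (a := 2) (b := 0) None u).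
Qed.

(** The hole is [Some x] if the triangle joins the two points, and [None] if the cycles do. *)
Lemma even_cover_near x (p q : 'I_30) : exists x' k,
  [/\ x' != Some (x - g), x' != Some (x + g)
  & even_frame x' k (Some (x - g), p) = (Some (x + g), q) \/
    even_frame x' k (Some (x + g), q) = (Some (x - g), p)].
Proof.
have n1 : near_centre x (x + g) by rewrite /near_centre eqxx.
have n2 : near_centre x (x - g) by rewrite /near_centre eqxx orbT.
have u := uniq_tri_cells x.
have [k [E|[E Ec]|[E Ec]]] := tri_cyc_cover p q.
- exists (Some x), k; split.
  + by apply: contraTneq n2 => -[<-]; rewrite near_centreN.
  + by apply: contraTneq n1 => -[<-]; rewrite near_centreN.
  rewrite /even_frame /= n1 n2 /=; case: E => E; [left|right].
    by apply: (spread_eq (a := 2) (b := 1) None u).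
  by apply: (spread_eq (a := 1) (b := 2) None u).
- exists None, k; split=> //; right; rewrite /even_frame /cyc_map /=.
  rewrite modnDl modn_small // in Ec.
  have d1 : ((30 + q) %/ 30)%N = 1%N by have := ltn_ord q; lia.
  rewrite Ec E inord_val d1 /= /step.
  by rewrite opprD addrA addrK.
exists None, k; split=> //; left; rewrite /even_frame /cyc_map /=.
have d2 : ((60 + p) %/ 30)%N = 2%N by have := ltn_ord p; lia.
have m2 : ((60 + p) %% 30)%N = p by have := ltn_ord p; lia.
rewrite m2 in Ec.
rewrite Ec E inord_val d2 /= /step.
by rewrite opprK addrA subrK.
Qed.

Lemma even_frameP : is_frame even_frame.
Proof.
split=> [x k|[y|] [z|] p q yz //]; first exact: even_frame_star; last first.
- exact: even_cover_inf.
- have [x [k [nx xz E]]] := even_cover_inf y q p.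
  by exists x, k; split=> //; case: E => E; [right|left].
have {}yz : y != z by apply: contra yz => /eqP ->.
have [x [xy xz zE]] := midpoint odd_A yz.
have [near|near] := boolP (near_centre x y).
  have mg : mirror x (x + g) = x - g by rewrite /mirror opprD addrA addrK.
  case/orP: near => /eqP yE.
    have [x' [k [H1 H2 E]]] := even_cover_near x q p.
    rewrite zE yE mg; exists x', k; split=> //.
    by case: E => E; [right|left].
  have [x' [k [H1 H2 E]]] := even_cover_near x p q.
  have pg : mirror x (x - g) = x + g by rewrite -mg mirrorK.
  by rewrite zE yE pg; exists x', k; split.
have yx : y != x by rewrite eq_sym.
have [k E] := pair_cover bip_cover odd_A p q yx zE; exists (Some x), k; split=> //.
rewrite /even_frame /= (_ : near_centre x z = false); last first.
  by rewrite zE near_mirror (negPf near).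
rewrite (negPf near) !size_map !size_pair_cells /=.
rewrite (_ : pair_cells x z = pair_cells x y); last by rewrite zE pair_cells_mirror.
by rewrite !spread_map; [case: E => ->; [left|right] | move=> ? ? [] | move=> ? ? []].
Qed.

End EvenFrame.

(** * The decomposition *)

Definition matching_map (T : finType) (m : T -> T) : Prop :=
  involutive m /\ forall x, m x != x.

Definition star_system (T Phi : finType) (m : T -> T) (c : Phi -> T -> T) : Prop :=
  (forall f, star_on [set: T] (c f)) /\
  (forall x y, x != y -> y != m x -> exists f, c f x = y \/ c f y = x).

Lemma perfect_matching_map (T : finType) (m : T -> T) :
  matching_map m -> perfect_matching [set [set x; m x] | x : T].
Proof.
case=> mK m_neq; split.
  by apply/subsetP => _ /imsetP[x _ ->]; rewrite inE cards2 (eq_sym x) m_neq.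
move=> x; apply/eqP/cards1P; exists [set x; m x]; apply/setP => e; rewrite !inE.
apply/andP/eqP => [[/imsetP[y _ ->]]|->]; last first.
  by split; [apply: imset_f | rewrite !inE eqxx].
by rewrite !inE => /orP[]/eqP -> //; rewrite mK setUC.
Qed.

Lemma matching_mapP (T : finType) (I : {set {set T}}) : perfect_matching I ->
  exists m : T -> T, matching_map m /\ forall x, [set x; m x] \in I.
Proof.
case=> sIK Ix.
have ex x : exists y, (y != x) && ([set x; y] \in I).
  have : 0 < #|[set e in I | x \in e]| by rewrite Ix.
  case/card_gt0P => e; rewrite inE => /andP[eI xe].
  have := subsetP sIK e eI; rewrite inE => /cards2P[a [b [ab eE]]].
  move: xe eI; rewrite {}eE !inE => /orP[]/eqP -> abI.
    by exists b; rewrite eq_sym ab.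
  by exists a; rewrite ab setUC.
pose m x := xchoose (ex x).
have mI x : [set x; m x] \in I by have /andP[] := xchooseP (ex x).
have m_neq x : m x != x by have /andP[] := xchooseP (ex x).
exists m; split=> //; split=> // x.
have /eqP/cards1P[e eE] := Ix (m x).
have e1 : [set x; m x] = e by apply/set1P; rewrite -eE !inE mI eqxx orbT.
have e2 : [set m x; m (m x)] = e by apply/set1P; rewrite -eE !inE mI eqxx.
have : m (m x) \in [set x; m x] by rewrite e1 -e2 !inE eqxx orbT.
by rewrite !inE (negPf (m_neq (m x))) orbF => /eqP.
Qed.

(** Selects one end of every matching edge by rank. *)
Definition half (T : finType) (m : T -> T) : seq T :=
  [seq x <- enum T | enum_rank x < enum_rank (m x)].

Lemma mem_half (T : finType) (m : T -> T) x :
  (x \in half m) = (enum_rank x < enum_rank (m x)).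
Proof. by rewrite mem_filter mem_enum andbT. Qed.

Lemma half_matching (T : finType) (m : T -> T) x :
  matching_map m -> (m x \in half m) = (x \notin half m).
Proof.
case=> mK m_neq; rewrite !mem_half mK -leqNgt [in RHS]leq_eqVlt.
by rewrite (inj_eq (@ord_inj _)) (inj_eq enum_rank_inj) (negPf (m_neq x)).
Qed.

Lemma uniq_half (T : finType) (m : T -> T) : uniq (half m).
Proof. exact/filter_uniq/enum_uniq. Qed.

Lemma size_half (T : finType) (m : T -> T) :
  matching_map m -> 2 * size (half m) = #|T|.
Proof.
move=> mm; have [mK _] := mm.
pose R := [set x in half m].
have cR : #|R| = size (half m) by rewrite cardsE; apply/card_uniqP/uniq_half.
have : #|~: R| = #|m @: R|.
  apply: eq_card => x; rewrite !inE -half_matching //.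
  apply/idP/imsetP => [mx|[y]]; first by exists (m x); rewrite ?inE // mK.
  by rewrite inE => yh ->; rewrite mK.
rewrite card_imset; last exact: inv_inj.
have := cardsC R; lia.
Qed.

(** Perfect matchings on equally many points are isomorphic: pair the selected ends by position and
    extend through the involutions. This carries one construction to any prescribed matching. *)
Lemma matching_iso (S T : finType) (s0 : S) (m : T -> T) (n : S -> S) :
    matching_map m -> matching_map n -> #|T| = #|S| ->
  exists2 h : T -> S, injective h & forall x, h (m x) = n (h x).
Proof.
move=> mm nn TS; have [mK m_neq] := mm; have [nK n_neq] := nn.
have sz : size (half m) = size (half n).
  by have := size_half mm; have := size_half nn; lia.
pose u x := nth s0 (half n) (index x (half m)).
pose h x := if x \in half m then u x else n (u (m x)).
have uh x : x \in half m -> u x \in half n.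
  by move=> xm; rewrite mem_nth // -sz index_mem.
have u_inj : {in half m &, injective u}.
  move=> x y xm ym /eqP; rewrite nth_uniq ?uniq_half -?sz ?index_mem //.
  by move=> /eqP e; rewrite -(nth_index x xm) e nth_index.
have hh x : (h x \in half n) = (x \in half m).
  rewrite /h; case: ifP => xm; first exact: uh.
  by rewrite half_matching // uh // half_matching // xm.
exists h => [x y hxy|x].
  have xy : (x \in half m) = (y \in half m) by rewrite -!hh hxy.
  move: hxy; rewrite /h xy; case: ifP => ym; first by apply: u_inj; rewrite ?xy.
  move=> /(inv_inj nK)/u_inj e; apply: (inv_inj mK); apply: e;
  by rewrite half_matching ?xy ?ym.
by rewrite /h half_matching //; case: (x \in half m); rewrite /= ?mK ?nK.
Qed.

Lemma decomposition_of_star_system (S T Phi : finType) (m : T -> T)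
    (c : Phi -> T -> T) (I : {set {set S}}) :
    perfect_matching I -> matching_map m -> star_system m c ->
    #|T| = #|S| -> 0 < #|S| -> 5 * #|Phi| + 6 = 3 * #|S| ->
  exists D, star_factor_decomposition 5 (complete_graph S :\: I) D.
Proof.
move=> pI mm [cP cov] TS S0 cPhi; have [n [nn nI]] := matching_mapP pI.
have /card_gt0P[s0 _] := S0.
have [h h_inj hm] := matching_iso s0 mm nn TS.
have [g hK gK] : bijective h by apply: inj_card_bij; rewrite ?TS.
apply: (decomposition_of_star_maps (c := fun f s => h (c f (g s)))) => //.
  move=> f; have -> : [set: S] = h @: [set: T].
    by apply/setP => s; rewrite inE -[s]gK imset_f.
  by apply: star_on_image (cP f) => // x _; rewrite hK.
move=> x y xy xyI; have [||f E] := cov (g x) (g y).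
- by rewrite (inj_eq (can_inj gK)).
- apply: contra xyI => /eqP gy; rewrite -[y]gK gy hm gK; exact: nI.
by exists f; case: E => ->; rewrite gK; [left|right].
Qed.

(** * Composing a frame with the designs on 12, 30 and 42 points *)

Section Composite.

Variables (X : finType) (fr : X -> 'I_18 -> X * 'I_30 -> X * 'I_30).
Variables (P12 P30 : 'I_6 -> seq (seq nat)) (P42 : 'I_18 -> seq (seq nat)).
Hypothesis frP : is_frame fr.
Hypothesis star12 : forall k, star_list (P12 k) (iota 0 12).
Hypothesis star30 : forall k, star_list (P30 k) (iota 0 30).
Hypothesis star42 : forall k, star_list (P42 k) (iota 0 42).

Let T : finType := ((X * 'I_30) + 'I_12)%type.
(** With t cells there are 18t + 6 indices, which is 3(v - 2)/5 for v = 30t + 12. *)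
Let Phi : finType := ((X * 'I_18) + 'I_6)%type.

Definition cell_point (x : X) (i : nat) : T :=
  if i < 30 then inl (x, inord i) else inr (inord (i - 30)).

Definition composite_map (z : T) : T :=
  match z with
  | inl (y, p) => inl (y, inord (shift 30 15 p))
  | inr h => inr (inord (shift 12 6 h))
  end.

Definition composite (f : Phi) (z : T) : T :=
  match f, z with
  | inl (x, k), inl (y, p) =>
    if y == x then cell_point x (centre (P42 k) p)
    else inl (fr x k (y, p))
  | inl (x, k), inr h => cell_point x (centre (P42 k) (30 + h))
  | inr j, inl (y, p) => inl (y, inord (centre (P30 j) p))
  | inr j, inr h => inr (inord (centre (P12 j) h))
  end.

Lemma composite_map_matching : matching_map composite_map.
Proof.
split=> [[[y p]|h]|[[y p]|h]] /=.
- have := ltn_ord p; rewrite /shift => p30; congr (inl (_, _)); apply: val_inj.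
  by rewrite /= !inordK; lia.
- have := ltn_ord h; rewrite /shift => p30; congr inr; apply: val_inj.
  by rewrite /= !inordK; lia.
- have := ltn_ord p => p30; apply/negP => /eqP[/(congr1 val)].
  by rewrite /shift /= inordK; lia.
- have := ltn_ord h => h12; apply/negP => /eqP E.
  have /(congr1 val) : inord (shift 12 6 h) = h by case: E.
  by rewrite /shift /= inordK; lia.
Qed.

Lemma inord_inj n i j : i <= n -> j <= n -> inord i = inord j :> 'I_n.+1 -> i = j.
Proof. by move=> ? ? /(congr1 val); rewrite /= !inordK. Qed.

Lemma cell_point_inj x : {in iota 0 42 &, injective (cell_point x)}.
Proof.
move=> i j; rewrite !mem_iota /= /cell_point => i42 j42.
case: ltnP => ci; case: ltnP => cj // [] /inord_inj; lia.
Qed.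

Lemma mem_cell_point x z :
  (z \in [set z in map (cell_point x) (iota 0 42)]) =
  (if z is inl (y, _) then y == x else true).
Proof.
rewrite in_set; apply/mapP; case: z => [[y p]|h].
  case: eqP => [->|yx].
    exists (val p); first by rewrite mem_iota /=; have := ltn_ord p; lia.
    by rewrite /cell_point ltn_ord inord_val.
  by case=> i _; rewrite /cell_point; case: ifP => _ // [].
exists (30 + h); first by rewrite mem_iota /=; have := ltn_ord h; lia.
by rewrite /cell_point ltnNge leq_addr /= addKn inord_val.
Qed.

Lemma composite_star f : star_on [set: T] (composite f).
Proof.
case: f => [[x k]|j].
  (* [B0] is the hole with the twelve points, handled by [P42]; [B1] consists of the other cells,
     handled by the frame. *)
  set B0 := [set z in map (cell_point x) (iota 0 42)].
  set B1 : {set T} := inl @: [set z : X * 'I_30 | z.1 != x].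
  have memB1 z : (z \in B1) = (z \notin B0).
    rewrite mem_cell_point; case: z => [[y p]|h] /=.
      by rewrite mem_imset ?inE // => ? ? [].
    by apply/negbTE/negP => /imsetP[].
  apply: (star_on_pieces (B := fun z => if z \in B0 then B0 else B1)).
    move=> z _; case: ifP => zB; split; rewrite ?memB1 ?zB ?subsetT //.
      apply: (star_on_list (iota_uniq 0 42) (star42 k)).
        exact: cell_point_inj.
      move=> i; rewrite mem_iota /= {2}/cell_point => i42.
      rewrite /cell_point; case: ltnP => ci /=; first by rewrite eqxx inordK.
      by rewrite inordK ?subnKC //; lia.
    apply: star_on_image (frP.1 x k); first by move=> ? ? [].
    by move=> [y p]; rewrite inE /= => /negPf ->.
  move=> y z _; case: ifP => yB; first by move=> ->.
  by rewrite memB1 => /negPf ->.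
set B0 := [set z : T in map (fun i => inr (inord i)) (iota 0 12)].
set B1 := fun y => [set z : T in map (fun i => inl (y, inord i)) (iota 0 30)].
have memB0 z : (z \in B0) = (if z is inr _ then true else false).
  rewrite in_set; apply/mapP; case: z => [z|h]; first by case.
  by exists (val h); rewrite ?inord_val // mem_iota ltn_ord.
have memB1 y z : (z \in B1 y) = (if z is inl (y', _) then y' == y else false).
  rewrite in_set; apply/mapP; case: z => [[y' p]|h]; last by case.
  case: eqP => [->|yy]; last by case=> i _ [].
  by exists (val p); rewrite ?inord_val // mem_iota ltn_ord.
apply: (star_on_pieces (B := fun z => if z is inl (y, _) then B1 y else B0)).
  move=> [[y p]|h] _; split; rewrite ?memB0 ?memB1 ?subsetT //.
    apply: (star_on_list (iota_uniq 0 30) (star30 j)).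
      by move=> i i'; rewrite !mem_iota /= => ? ? [] /inord_inj; apply.
    by move=> i; rewrite mem_iota /= => ?; rewrite inordK.
  apply: (star_on_list (iota_uniq 0 12) (star12 j)).
    by move=> i i'; rewrite !mem_iota /= => ? ? [] /inord_inj; apply.
  by move=> i; rewrite mem_iota /= => ?; rewrite inordK.
by move=> [[y p]|h] [[y' p']|h'] _; rewrite ?memB0 ?memB1 // => /eqP ->.
Qed.

Hypothesis cover12 : forall h h' : 'I_12, h != h' -> h' != shift 12 6 h :> nat ->
  exists k, linked (P12 k) h h'.
Hypothesis cover30 : forall p q : 'I_30, p != q -> q != shift 30 15 p :> nat ->
  (exists k, linked (P42 k) p q) \/ (exists k, linked (P30 k) p q).
Hypothesis cover42 : forall (p : 'I_30) (h : 'I_12), exists k, linked (P42 k) p (30 + h).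

Lemma composite_cover12 (h h' : 'I_12) : h != h' ->
    h' != inord (shift 12 6 h) ->
  exists f, composite f (inr h) = inr h' \/ composite f (inr h') = inr h.
Proof.
move=> hh hm; have [|k E] := cover12 hh.
  by apply: contra hm => /eqP hE; apply/eqP/val_inj; rewrite /= inordK -hE.
exists (inr k).
by case: E => E; [left | right]; rewrite /= E inord_val.
Qed.

Lemma composite_cover30 (x : X) (p q : 'I_30) : p != q ->
    q != inord (shift 30 15 p) ->
  exists f, composite f (inl (x, p)) = inl (x, q) \/
            composite f (inl (x, q)) = inl (x, p).
Proof.
move=> pq pm; have [|[k E]|[k E]] := cover30 pq.
- by apply: contra pm => /eqP qE; apply/eqP/val_inj; rewrite /= inordK -qE.
- exists (inl (x, k)); rewrite /= eqxx.
  by case: E => E; [left | right]; rewrite /cell_point E ltn_ord inord_val.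
exists (inr k).
by case: E => E; [left | right]; rewrite /= E inord_val.
Qed.

Lemma composite_cover42 (x : X) (p : 'I_30) (h : 'I_12) :
  exists f, composite f (inl (x, p)) = inr h \/
            composite f (inr h) = inl (x, p).
Proof.
have [k E] := cover42 p h; exists (inl (x, k)); rewrite /= eqxx.
case: E => E; [left | right]; rewrite /cell_point E.
  by rewrite ltnNge leq_addr /= addKn inord_val.
by rewrite ltn_ord inord_val.
Qed.

Lemma composite_system : star_system composite_map composite.
Proof.
split=> [|[[y p]|h] [[z q]|h'] yz zm]; first exact: composite_star.
- have [yzE|yzE] := eqVneq y z.
    rewrite -{z}yzE in yz zm *; apply: composite_cover30.
      by apply: contra yz => /eqP ->.
    by apply: contra zm => /eqP ->.
  have [x [k [xy xz E]]] := frP.2 y z p q yzE.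
  exists (inl (x, k)); rewrite /= eq_sym (negPf xy) eq_sym (negPf xz).
  by case: E => ->; [left | right].
- exact: composite_cover42.
- by have [f E] := composite_cover42 z q h; exists f; case: E; [right | left].
apply: composite_cover12; first by apply: contra yz => /eqP ->.
by apply: contra zm => /eqP ->.
Qed.

End Composite.

(** As an integer, a + a is a multiple of the modulus and less than twice it. It is not the modulus
    itself, by parity, so it is 0. *)
Lemma Zp_odd n (a : 'I_n.+1) : odd n.+1 -> (a + a = 0 -> a = 0)%R.
Proof.
move=> odd_n /(congr1 val) /= aa; apply: val_inj => /=.
have := ltn_ord a; have := divn_eq (a + a) n.+1; rewrite aa => e a_n.
have q2 : (a + a) %/ n.+1 < 2 by rewrite ltn_divLR //; lia.
move: e q2; case: (_ %/ _) => [|[|//]] e _; first by lia.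
by move/(congr1 odd): e; rewrite mul1n addn0 odd_n oddD addbb.
Qed.

Lemma frame_exists t : t != 2 -> exists (X : finType)
  (fr : X -> 'I_18 -> X * 'I_30 -> X * 'I_30), is_frame fr /\ #|X| = t.
Proof.
move=> t2; case: t t2 => [|t] t2.
  exists 'I_0, (fun x k z => z); rewrite card_ord; split=> //.
  by split=> [[]|[]].
have [odd_t|even_t] := boolP (odd t.+1).
  have [B [Bs Bc]] := bip_gadget.
  exists 'I_t.+1, (@odd_frame 'I_t.+1 B); rewrite card_ord; split=> //.
  by apply: odd_frameP => // a; apply: Zp_odd.
(* At least four cells remain, so removing oo leaves a group of odd order at least 3, where 1 is a
   nonzero choice of g. *)
case: t t2 even_t => [//|[//|t]] _ /=; rewrite !negbK => odd_t.
have [B [Bs Bc]] := bip_gadget.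
have [R [C [Rs Rc Cs RCc]]] := tri_cyc_gadget.
pose g : 'I_t.+1.+1 := inord 1.
exists (option 'I_t.+1.+1), (@even_frame 'I_t.+1.+1 g B R C).
rewrite card_option card_ord; split=> //; apply: (@even_frameP _ g) => //.
  by move=> a; apply: Zp_odd; rewrite /= negbK odd_t.
by apply/eqP => /(congr1 val); rewrite /= inordK.
Qed.

Definition map72 (z : 'I_72) : 'I_72 := inord (shift 36 18 z).

Lemma map72_matching : matching_map map72.
Proof.
have val72 z : map72 z = shift 36 18 z :> nat.
  by rewrite inordK // /shift; have := ltn_ord z; lia.
split=> z; first by apply: val_inj; rewrite /= !val72 /shift; have := ltn_ord z; lia.
apply/negP => /eqP/(congr1 val); rewrite /= val72 /shift; have := ltn_ord z; lia.
Qed.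

Lemma system72 : exists c : 'I_42 -> 'I_72 -> 'I_72, star_system map72 c.
Proof.
have [P [Ps Pc]] := factors72_exist.
exists (fun k z => inord (centre (P k) z)); split=> [k|x y xy ym].
  have -> : [set: 'I_72] = [set z in map inord (iota 0 72)].
    apply/setP => z; rewrite in_setT [RHS]in_set; apply/esym/mapP.
    by exists (val z); rewrite ?inord_val // mem_iota ltn_ord.
  apply: (star_on_list (iota_uniq 0 72) (Ps k)).
  - by move=> i j; rewrite !mem_iota /= => ? ? /inord_inj; apply.
  - by move=> i; rewrite mem_iota /= => ?; rewrite inordK.
have [|k E] := Pc x y xy.
  by apply: contra ym => /eqP yE; apply/eqP/val_inj; rewrite /= inordK -yE.
by exists k; case: E => E; [left | right]; rewrite E inord_val.
Qed.

Lemma decomposition_exists (S : finType) (I : {set {set S}}) :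
    perfect_matching I -> #|S| = 12 %[mod 30] ->
  exists D, star_factor_decomposition 5 (complete_graph S :\: I) D.
Proof.
move=> pI S12; pose t := #|S| %/ 30.
have cS : #|S| = 30 * t + 12 by rewrite (divn_eq #|S| 30) S12 mulnC.
(* Two cells admit no frame: an edge between them would need a third cell as hole. *)
have [t2|t2] := eqVneq t 2.
  have [c cP] := system72.
  apply: (decomposition_of_star_system pI map72_matching cP);
  by rewrite ?card_ord cS t2.
have [X [fr [frP cX]]] := frame_exists t2.
have [P12 [P30 [P42 [[s12 s30 s42] c12 c30 c42]]]] := fill_gadget.
apply: (decomposition_of_star_system pI (composite_map_matching X)
          (composite_system frP s12 s30 s42 c12 c30 c42));
rewrite ?card_sum ?card_prod ?card_ord ?cX ?cS; lia.
Qed.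

Lemma perfect_matching_exists v : ~~ odd v ->
  exists I : {set {set 'I_v}}, perfect_matching I.
Proof.
(* The matching pairs 2j with 2j + 1; it stays below [v] because an even last point would make [v]
   odd. *)
move=> even_v; pose s i := if odd i then i.-1 else i.+1.
have s_lt (i : 'I_v) : s i < v.
  rewrite /s; case: ifP => oi; first by apply: leq_ltn_trans (leq_pred i) _.
  rewrite ltn_neqAle ltn_ord andbT; apply: contra even_v => /eqP <-.
  by rewrite /= oi.
pose m i := Ordinal (s_lt i).
exists [set [set x; m x] | x : 'I_v]; apply: perfect_matching_map.
have sK i : s (s i) = i.
  rewrite /s; have [oi|oi] := boolP (odd i); last by rewrite /= oi.
  by case: i oi => //= i /negbTE ->.
split=> i; first by apply: val_inj; exact: sK.
rewrite -val_eqE /= /s; case: ifP => [|_]; last by rewrite gtn_eqF.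
by case: (val i) => //= j _; rewrite ltn_eqF.
Qed.

Theorem mainTheorem1 (v : nat) :
  (3 <= v ->
   ((exists I : {set {set 'I_v}},
       perfect_matching I /\
       exists D : {set {set {set 'I_v}}},
         star_factor_decomposition 5 (complete_graph 'I_v :\: I) D)
    <-> v = 12 %[mod 30]))
  /\
  (4 <= v -> ~~ odd v ->
   forall I : {set {set 'I_v}}, perfect_matching I ->
   ((exists D : {set {set {set 'I_v}}},
       star_factor_decomposition 5 (complete_graph 'I_v :\: I) D)
    <-> v = 12 %[mod 30])).
Proof.
split=> [v3|v4 _ I pI]; split.
- case=> I [pI [D DP]].
  by have := star_factor_decomposition_mod30 pI _ DP; rewrite card_ord; apply.
- move=> v12; have [|I pI] := @perfect_matching_exists v; first by lia.
  by exists I; split=> //; apply: decomposition_exists; rewrite ?card_ord.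
- case=> D DP; have := star_factor_decomposition_mod30 pI _ DP.
  by rewrite card_ord; apply; lia.
by move=> v12; apply: decomposition_exists; rewrite ?card_ord.
Qed.
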